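(* Let $1\le n\le 3$, suppose that $g$ satisfies Assumption B if $n=1$ and Assumption C if $n\in\{2,3\}$, and set $\mathcal G(u)(x):=g(x,u(x))$ for a.e. $x\in\Omega$. Let $s$ be the exponent $1\le s<\infty$ of Assumption B if $n=1$, and let $s=1$ if $n\in\{2,3\}$. Then for every $u\in H_0^1(\Omega)$ one has $\mathcal G(u)\in L^2(\Omega)$ and $$\|\mathcal G(u)\|\le C\bigl(1+\|u\|_{H_0^1(\Omega)}^s\bigr),$$ where $C>0$ is independent of $u$. Furthermore, for any $M>0$ there is a constant $C(M)>0$ such that for all $u_1,u_2\in H_0^1(\Omega)$ with $\|u_i\|_{H_0^1(\Omega)}\le M$ ($i=1,2$), $$\|\mathcal G(u_1)-\mathcal G(u_2)\|\le C(M)\|u_1-u_2\|.$$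
   Context: $\Omega\subset\mathbb R^n$ is a bounded domain with $C^{1,1}$ boundary $\Gamma$. $\|\cdot\|$ and $(\cdot,\cdot)$ denote the norm and inner product of $L^2(\Omega)$; $H_0^1(\Omega)$ is the closure of $C_c^\infty(\Omega)$ in $H^1(\Omega)$. $D_u^j g$ is the $j$-th derivative of $g(x,u)$ with respect to $u$ ($D_u^0g=g$). Assumption B (used for $n=1$): (i) $g:\Omega\times\mathbb R\to\mathbb R$ is a Carathéodory function. (ii) $g(x,u)$ is three times continuously differentiable with respect to $u$, and for any $M>0$ there is $L_M>0$ such that $|D_u^jg(x,u_1)-D_u^jg(x,u_2)|\le L_M|u_1-u_2|$ for $0\le j\le 2$, a.e. $x\in\Omega$, and all $u_1,u_2\in\mathbb R$ with $|u_i|\le M$. (iii) There exist $b>0$, $a\in L^2(\Omega)$ and some $1\le s<\infty$ such that $|g(x,u)|\le a(x)+b|u|^s$ for a.e. $x\in\Omega$ and any $u\in\mathbb R$. Assumption C (used for $n=2,3$): (i) $g:\Omega\times\mathbb R\to\mathbb R$ is a Carathéodory function. (ii) $g(x,u)$ is three times continuously differentiable with respect to $u$, $g(\cdot,0)\in L^2(\Omega)$, and there is $L_0>0$ such that $|D_u^jg(x,u_1)-D_u^jg(x,u_2)|\le L_0|u_1-u_2|$ for $0\le j\le2$, a.e. $x\in\Omega$ and all $u_1,u_2\in\mathbb R$. *)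

(* Defs.v *)
From HB Require Import structures.
From mathcomp Require Import all_boot all_order all_algebra.
From mathcomp Require Import all_classical all_reals all_analysis.

Set Implicit Arguments.
Unset Strict Implicit.
Unset Printing Implicit Defensive.

Import Order.TTheory GRing.Theory Num.Theory.
Import numFieldNormedType.Exports.

Local Open Scope classical_set_scope.
Local Open Scope ring_scope.

(** * Lebesgue measure on R^n

    The library has no Lebesgue measure on ['rV[R]_n].  It is built as the
    n-fold product of the one-dimensional Lebesgue measure on the sigma-algebra
    generated by the coordinates (the Borel one), and then completed. *)

Definition coord_generator (R : realType) (n : nat) : set (set 'rV[R]_n) :=
  [set A : set 'rV[R]_n | exists (i : 'I_n) (B : set R),
     measurable B /\ A = [set x : 'rV[R]_n | B (x ord0 i)]].

Definition borelRn (R : realType) (n : nat) : measurableType _ :=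
  g_sigma_algebraType (@coord_generator R n).

Section product_step.
Context (R : realType) (n : nat).
Variable m : {sigma_finite_measure set (borelRn R n) -> \bar R}.

Definition consRn (p : R * borelRn R n) : borelRn R n.+1 :=
  row_mx (const_mx p.1 : 'rV[R]_1) (p.2 : 'rV[R]_n).

Definition unconsRn (x : borelRn R n.+1) : R * borelRn R n :=
  ((x : 'rV[R]_(1 + n)) ord0 (lshift n ord0), rsubmx (x : 'rV[R]_(1 + n))).

Lemma consRnK : cancel consRn unconsRn.
Proof.
by move=> [t y]; rewrite /unconsRn /consRn /= row_mxEl mxE row_mxKr.
Qed.

Lemma measurable_coord k (i : 'I_k) :
  measurable_fun [set: borelRn R k] (fun x : borelRn R k => (x : 'rV[R]_k) ord0 i).
Proof.
by move=> _ B mB; rewrite setTI; apply: sub_sigma_algebra; exists i, B.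
Qed.

Lemma measurable_borelRn d (T : measurableType d) k (f : T -> borelRn R k) :
  (forall i, measurable_fun setT (fun t => (f t : 'rV[R]_k) ord0 i)) ->
  measurable_fun setT f.
Proof.
move=> mf; apply: (@measurability _ _ T (borelRn R k) setT f (@coord_generator R k)) => //.
by move=> _ [_ [i [B [mB ->]]] <-]; exact: (mf i measurableT B mB).
Qed.

Lemma consRn0 p : (consRn p : 'rV[R]_n.+1) ord0 ord0 = p.1.
Proof.
rewrite (_ : ord0 = lshift n (ord0 : 'I_1) :> 'I_n.+1); last exact/val_inj.
by apply: etrans; [exact: row_mxEl|rewrite mxE].
Qed.

Lemma consRnS p j :
  (consRn p : 'rV[R]_n.+1) ord0 (lift ord0 j) = (p.2 : 'rV[R]_n) ord0 j.
Proof.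
rewrite (_ : lift ord0 j = rshift 1 j :> 'I_n.+1); last exact/val_inj.
exact: row_mxEr.
Qed.

Lemma measurable_consRn : measurable_fun setT consRn.
Proof.
apply: measurable_borelRn => i; case: (unliftP ord0 i) => [j|] ->.
  rewrite (_ : (fun _ => _) =
      (fun x : borelRn R n => (x : 'rV[R]_n) ord0 j) \o snd); last first.
    by apply/funext => p; exact: consRnS.
  by apply: measurableT_comp; [exact: measurable_coord|exact: measurable_snd].
rewrite (_ : (fun _ => _) = fst); first exact: measurable_fst.
by apply/funext => p; exact: consRn0.
Qed.

Lemma measurable_unconsRn : measurable_fun setT unconsRn.
Proof.
apply/measurable_fun_pairP; split.
  exact: measurable_coord.
apply: measurable_borelRn => i.
rewrite (_ : (fun _ => _) = fun x : borelRn R n.+1 =>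
  (x : 'rV[R]_(1 + n)) ord0 (rshift 1 i)); first exact: measurable_coord.
by apply/funext => x; rewrite /= mxE.
Qed.

Definition product_step : set (borelRn R n.+1) -> \bar R :=
  pushforward (@lebesgue_measure R \x m)%E consRn.

Let product_step0 : product_step set0 = 0%E.
Proof. by rewrite /product_step /pushforward preimage_set0 measure0. Qed.

Let product_step_ge0 A : (0 <= product_step A)%E.
Proof. by rewrite /product_step /pushforward; exact: measure_ge0. Qed.

Let product_step_sigma_additive : semi_sigma_additive product_step.
Proof.
move=> F mF tF mUF; rewrite /product_step /pushforward preimage_bigcup.
apply: measure_semi_sigma_additive.
- by move=> k; rewrite -[X in measurable X]setTI; exact: measurable_consRn.
- apply/trivIsetP => /= i j _ _ ij; rewrite -preimage_setI.
  by move/trivIsetP : tF => ->//; rewrite preimage_set0.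
- by rewrite -preimage_bigcup -[X in measurable X]setTI; exact: measurable_consRn.
Qed.

HB.instance Definition _ := isMeasure.Build _ _ _ product_step
  product_step0 product_step_ge0 product_step_sigma_additive.

Let product_step_sigma_finite : sigma_finite setT product_step.
Proof.
have [F TF mF] := sigma_finiteT (@lebesgue_measure R).
have [G TG mG] := sigma_finiteT m.
have mFG : forall k, product_step (unconsRn @^-1` ((F k.1) `*` (G k.2))) =
    (lebesgue_measure (F k.1) * m (G k.2))%E.
  move=> [k l] /=; have [mFk _] := mF k; have [mGl _] := mG l.
  rewrite -(product_measure1E (@lebesgue_measure R) m)//.
  rewrite /product_step /pushforward -comp_preimage.
  rewrite (_ : unconsRn \o consRn = id)//.
  by apply/funext => p /=; rewrite consRnK.
pose dec (k : nat) : nat * nat := odflt (0, 0)%N (choice.unpickle k).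
exists (fun k => unconsRn @^-1` (F (dec k).1 `*` G (dec k).2)).
  apply/esym/seteqP; split => // x _.
  have : [set: R] (unconsRn x).1 by [].
  rewrite TF => -[k _ Fk].
  have : [set: borelRn R n] (unconsRn x).2 by [].
  rewrite TG => -[l _ Gl].
  by exists (choice.pickle (k, l)) => //; rewrite /dec choice.pickleK; split.
move=> k; have [mFk Fkoo] := mF (dec k).1; have [mGk Gkoo] := mG (dec k).2.
split.
  rewrite -[X in measurable X]setTI; apply: measurable_unconsRn => //.
  exact: measurableX.
by rewrite (mFG (dec k)) lte_mul_pinfty// ge0_fin_numE.
Qed.

HB.instance Definition _ := Measure_isSigmaFinite.Build _ _ _ product_step
  product_step_sigma_finite.

End product_step.

Fixpoint borel_lebesgueRn (R : realType) (n : nat) :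
    {sigma_finite_measure set (borelRn R n) -> \bar R} :=
  match n with
  | 0 => dirac ((0 : 'rV[R]_0) : borelRn R 0)
  | k.+1 => product_step (borel_lebesgueRn R k)
  end.

Lemma measurable_box (R : realType) (n : nat) (A : 'I_n -> set R) :
  (forall i, measurable (A i)) ->
  measurable ([set x : 'rV[R]_n | forall i, A i (x ord0 i)] : set (borelRn R n)).
Proof.
move=> mA; rewrite (_ : mkset _ = \bigcap_(i in [set: 'I_n])
    ((fun x : borelRn R n => (x : 'rV[R]_n) ord0 i) @^-1` A i)).
  apply: fin_bigcap_measurable => // i _.
  by rewrite -[X in measurable X]setTI; exact: measurable_coord.
by apply/seteqP; split => [x Ax i _|x Ax i]; [exact: Ax|exact: (Ax i I)].
Qed.

Lemma borel_lebesgueRn_box (R : realType) (n : nat) (A : 'I_n -> set R) :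
  (forall i, measurable (A i)) ->
  (borel_lebesgueRn R n [set x : 'rV[R]_n | forall i, A i (x ord0 i)] =
   \prod_(i < n) lebesgue_measure (A i))%E.
Proof.
elim: n A => [|n ih] A mA.
  by rewrite big_ord0 /= diracE mem_set// => -[].
rewrite big_ord_recl -(ih (fun i => A (lift ord0 i)))// /= /product_step /pushforward.
pose B := [set y : 'rV[R]_n | forall i, A (lift ord0 i) (y ord0 i)].
have mB : measurable (B : set (borelRn R n)).
  exact: (measurable_box (fun i => mA (lift ord0 i))).
rewrite -[RHS](product_measure1E lebesgue_measure (borel_lebesgueRn R n))//; last exact: mA.
congr (_ _); apply/seteqP; split => [[t y] /= Aty|[t y] /= [At Ay] i].
  split => [|i]; first by have := Aty ord0; rewrite consRn0.
  by have := Aty (lift ord0 i); rewrite consRnS.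
by case: (unliftP ord0 i) => [j|] ->; rewrite ?consRnS ?consRn0.
Qed.

(** The Lebesgue sigma-algebra is the Caratheodory one, so that the measure is
    complete: functions that agree a.e. are simultaneously measurable. *)

Definition lebesgueRn_type (R : realType) (n : nat) : measurableType _ :=
  caratheodory_type ((borel_lebesgueRn R n)^*)%mu.

Definition lebesgueRn (R : realType) (n : nat) :
    {measure set (lebesgueRn_type R n) -> \bar R} :=
  @completed_measure_extension _ _ _ (borel_lebesgueRn R n).

Lemma lebesgueRn_box (R : realType) (n : nat) (A : 'I_n -> set R) :
  (forall i, measurable (A i)) ->
  (lebesgueRn R n [set x : 'rV[R]_n | forall i, A i (x ord0 i)] =
   \prod_(i < n) lebesgue_measure (A i))%E.
Proof.
move=> mA; rewrite -(borel_lebesgueRn_box mA).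
rewrite /= /completed_measure_extension /= measurable_mu_extE//.
exact: measurable_box.
Qed.

(** * L^2(Omega)

    Functions on Omega are total functions on R^n whose values outside Omega
    are irrelevant; [f \_ Omega] is the extension of [f] by zero. *)

Section sobolev.
Context (R : realType) (n : nat).
Implicit Types (Omega : set 'rV[R]_n) (f u v phi : 'rV[R]_n -> R).

Definition L2 Omega f : Prop :=
  (f \_ Omega : lebesgueRn_type R n -> R) \in Lfun (lebesgueRn R n) 2%:E.

Definition L2norm Omega f : R :=
  fine ('N[lebesgueRn R n]_2%:E
          [EFin \o (f \_ Omega : lebesgueRn_type R n -> R)])%E.

Definition partial (i : 'I_n) f : 'rV[R]_n -> R :=
  'D_(delta_mx ord0 i) f.

(** All iterated partial derivatives, of every order, exist and are
    continuous. *)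
Definition smooth f : Prop :=
  forall s : seq 'I_n,
    let h := foldr partial f s in
    continuous h /\ forall i x, derivable h x (delta_mx ord0 i).

Definition Cc_infty Omega phi : Prop :=
  let supp := closure [set x | phi x != 0] in
  [/\ smooth phi, compact supp & supp `<=` Omega].

Definition is_weak_partial Omega (i : 'I_n) u v : Prop :=
  L2 Omega v /\
  forall phi, Cc_infty Omega phi ->
    Rintegral (lebesgueRn R n) Omega (fun x => u x * partial i phi x) =
    - Rintegral (lebesgueRn R n) Omega (fun x => v x * phi x).

Definition H1 Omega u : Prop :=
  L2 Omega u /\ forall i, exists v, is_weak_partial Omega i u v.

(** Weak derivatives are unique up to a null set, so the choice below does not
    affect [H1norm]. *)
Definition weak_partial Omega (i : 'I_n) u : 'rV[R]_n -> R :=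
  xget (fun=> 0) [set v | is_weak_partial Omega i u v].

Definition H1norm Omega u : R :=
  Num.sqrt (L2norm Omega u ^+ 2 +
            \sum_(i < n) L2norm Omega (weak_partial Omega i u) ^+ 2).

(** [H^1_0] carries the norm of [H^1]. *)
Definition H10 Omega u : Prop :=
  H1 Omega u /\
  forall e, 0 < e -> exists2 phi, Cc_infty Omega phi & H1norm Omega (u \- phi) < e.

(** * Bounded domains with C^{1,1} boundary *)

Definition bounded_domain Omega : Prop :=
  [/\ Omega !=set0, open Omega, connected Omega & bounded_set Omega].

End sobolev.

Definition C11 (R : realType) (n : nat) (gamma : 'rV[R]_n -> R) : Prop :=
  forall i, (forall x, derivable gamma x (delta_mx ord0 i)) /\
            lipschitz (partial i gamma).

(** Near each boundary point, in suitable orthonormal coordinates [x *m Q],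
    Omega is the region above the graph of a C^{1,1} function [gamma]: the
    [k]-th coordinate is compared with [gamma] of the remaining ones.  For
    [n = 1] the function [gamma] is a constant. *)
Definition C11_boundary (R : realType) (n : nat) (Omega : set 'rV[R]_n) : Prop :=
  forall x0, (closure Omega `\` interior Omega) x0 ->
  exists r (Q : 'M[R]_n) (k : 'I_n) (gamma : 'rV[R]_n.-1 -> R),
    [/\ 0 < r, Q *m Q^T = 1%:M, C11 gamma &
        forall x, ball x0 r x ->
          (Omega x <-> gamma (col' k (x *m Q)) < (x *m Q) ord0 k)].

(** * Assumptions on the nonlinearity *)

Section nonlinearity.
Context (R : realType) (n : nat).
Implicit Types (Omega : set 'rV[R]_n) (g : 'rV[R]_n -> R -> R).

Definition ae_on Omega (P : 'rV[R]_n -> Prop) : Prop :=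
  {ae lebesgueRn R n, forall x, Omega x -> P x}.

Definition caratheodory_function Omega g : Prop :=
  (forall u, measurable_fun (Omega : set (lebesgueRn_type R n)) (g ^~ u)) /\
  ae_on Omega (fun x => continuous (g x)).

Definition C3 (h : R -> R) : Prop :=
  (forall j u, (j < 3)%N -> derivable (derive1n j h) u 1) /\ continuous (derive1n 3 h).

Definition assumptionB Omega g (s : R) : Prop :=
  [/\ caratheodory_function Omega g,
      ae_on Omega (fun x => C3 (g x)),
      (forall M, 0 < M -> exists2 L, 0 < L &
         forall j, (j <= 2)%N -> ae_on Omega (fun x =>
           forall u1 u2, `|u1| <= M -> `|u2| <= M ->
             `|derive1n j (g x) u1 - derive1n j (g x) u2| <= L * `|u1 - u2|)) &
      1 <= s /\ exists b (a : 'rV[R]_n -> R),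
        [/\ 0 < b, L2 Omega a &
            ae_on Omega (fun x => forall u, `|g x u| <= a x + b * `|u| `^ s)]].

Definition assumptionC Omega g : Prop :=
  [/\ caratheodory_function Omega g,
      ae_on Omega (fun x => C3 (g x)),
      L2 Omega (g ^~ 0) &
      exists2 L0, 0 < L0 &
        forall j, (j <= 2)%N -> ae_on Omega (fun x =>
          forall u1 u2, `|derive1n j (g x) u1 - derive1n j (g x) u2| <= L0 * `|u1 - u2|)].

Definition superposition g (u : 'rV[R]_n -> R) : 'rV[R]_n -> R :=
  fun x => g x (u x).

End nonlinearity.

(* Main.v *)
Require Import Defs.
From mathcomp Require Import all_boot all_order all_algebra.
From mathcomp Require Import lra.
From mathcomp Require Import all_classical all_reals all_analysis.
From mathcomp Require Import measurable_realfun.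

(** In dimensions 2 and 3, [g x] is globally Lipschitz, so everything follows
    from the triangle inequality in L^2.  In dimension 1, it suffices to show
    [|u| <= K (1 + ||u||_{H^1})] almost everywhere for [u] in H^1_0: the growth
    condition and the local Lipschitz condition then apply on a bounded range.
    For a test function [phi], the fundamental theorem of calculus and
    Cauchy-Schwarz give [|phi| <= K ||phi'||].  If [phi] is H^1-close to [u],
    then [phi = u - (u - phi)] has the difference [v] of the chosen weak
    derivatives of [u] and [u - phi] as a weak derivative.  Testing against
    [phi'], which is itself a test function, yields [||phi'|| <= ||v||], so the
    uniqueness of weak derivatives is never needed.  Finally, the excess
    [max 0 (|u| - K (1 + ||u||_{H^1}))] is dominated by [|u - phi|], whose norm
    is arbitrarily small. *)

Set Implicit Arguments.
Unset Strict Implicit.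
Unset Printing Implicit Defensive.

Import Order.TTheory GRing.Theory Num.Theory.
Import numFieldNormedType.Exports.

Local Open Scope classical_set_scope.
Local Open Scope ring_scope.

(** * Measurability with respect to the completed Lebesgue measure *)

Lemma measurable_lebesgueRn (R : realType) (n : nat) (A : set 'rV[R]_n) :
  measurable (A : set (borelRn R n)) ->
  measurable (A : set (lebesgueRn_type R n)).
Proof.
by move=> mA; apply: sub_caratheodory; exact: sub_sigma_algebra.
Qed.

Lemma lebesgueRn_complete (R : realType) (n : nat) :
  measure_is_complete (lebesgueRn R n).
Proof. exact: measure_is_complete_caratheodory. Qed.

(** An open set is the union of the countably many boxes with rational centre and half-width
    [k.+1%:R^-1] that it contains. *)
Lemma open_measurable_lebesgueRn (R : realType) (n : nat) (A : set 'rV[R]_n) :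
  open A -> measurable (A : set (lebesgueRn_type R n)).
Proof.
move=> oA; apply: measurable_lebesgueRn.
pose box (q : 'rV[rat]_n) (k : nat) :=
  [set x : 'rV[R]_n | forall i, `](ratr (q ord0 i) - k.+1%:R^-1)%R,
                                  (ratr (q ord0 i) + k.+1%:R^-1)%R[%classic (x ord0 i)].
pose F (p : 'rV[rat]_n * nat) : set (borelRn R n) :=
  if `[< box p.1 p.2 `<=` A >] then box p.1 p.2 else set0.
rewrite (_ : A = \bigcup_p F p); last first.
  apply/seteqP; split=> [x Ax|x [p _]]; last first.
    by rewrite /F; case: asboolP => // + ?; apply.
  have /nbhs_ballP[e /= e0 xeA] : nbhs x A by exact: open_nbhs_nbhs.
  (* The half-width is below [e / 2], so a box whose centre is that close to [x] in each coordinate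
     stays inside the ball of radius [e] around [x]. *)
  pose k := Num.truncn (2 / e).
  have ke : k.+1%:R^-1 < e / 2.
    rewrite -[ltRHS]invrK ltf_pV2 ?posrE// ?invr_gt0 ?divr_gt0//.
    by rewrite invfM invrK mulrC truncnS_gt.
  have /choice[q xq] : forall i, exists q : rat, `|x ord0 i - ratr q| < k.+1%:R^-1.
    move=> i; have /rat_in_itvoo[q] : x ord0 i - k.+1%:R^-1 < x ord0 i + k.+1%:R^-1.
      by rewrite ltrD2l gt0_cp// invr_gt0.
    by rewrite in_itv/= -ltr_distlC; exists q.
  exists (\row_i q i, k) => //; rewrite /F; case: asboolP => [_ i|].
    by rewrite /= in_itv/= mxE -ltr_distl.
  case=> y yq; apply: (xeA y); rewrite /ball/=; split => // i j; rewrite (ord1 i) /ball/=.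
  have := yq j; rewrite /= in_itv/= mxE -ltr_distlC => qy.
  rewrite -(subrKA (ratr (q j))) (le_lt_trans (ler_normD _ _))//.
  rewrite (splitr e) ltrD// (lt_trans _ ke)//.
apply: (@countable_bigcupT_measurable _ (borelRn R n) _ F).
  exact: countableP.
move=> -[q k]; rewrite /F; case: asboolP => // _.
apply: (@measurable_box R n (fun i => `](ratr (q ord0 i) - k.+1%:R^-1)%R,
                                  (ratr (q ord0 i) + k.+1%:R^-1)%R[%classic)).
by move=> i; exact: measurable_itv.
Qed.

(** Rounding [u] down to a grid of mesh [k.+1%:R^-1] leaves countably many sections of [g], each
    measurable. Continuity of [g x] passes to the limit off a null set, which completeness of the
    measure absorbs. *)
Lemma measurable_superposition (R : realType) (n : nat) (Omega : set 'rV[R]_n)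
    (g : 'rV[R]_n -> R -> R) (u : 'rV[R]_n -> R) :
  measurable (Omega : set (lebesgueRn_type R n)) ->
  caratheodory_function Omega g ->
  measurable_fun (Omega : set (lebesgueRn_type R n)) u ->
  measurable_fun (Omega : set (lebesgueRn_type R n)) (superposition g u).
Proof.
move=> mO [mg [N [mN N0 gN]]] mu.
pose h (k : nat) (x : lebesgueRn_type R n) : R :=
  g x ((Num.floor (k.+1%:R * u x))%:~R / k.+1%:R).
have mh k : measurable_fun (Omega : set (lebesgueRn_type R n)) (h k).
  move=> _ Y mY.
  pose F (z : int) : set (lebesgueRn_type R n) :=
    (Omega `&` u @^-1` `[z%:~R / k.+1%:R, (z + 1)%:~R / k.+1%:R[) `&`
    (Omega `&` (g ^~ (z%:~R / k.+1%:R)) @^-1` Y).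
  have k0 : 0 < k.+1%:R :> R by [].
  rewrite (_ : _ `&` _ = \bigcup_z F z); last first.
    apply/seteqP; split=> [x [Ox Yx]|x [z _ [[Ox]]]].
      exists (Num.floor (k.+1%:R * u x)) => //; split; split => //=.
      rewrite in_itv/= ler_pdivrMr// ltr_pdivlMr// mulrC floor_le/=.
      exact: floorD1_gt.
    rewrite /= in_itv/= ler_pdivrMr// ltr_pdivlMr// => zu [_ Yx]; split => //.
    by rewrite /h (@floor_def _ _ z)// mulrC.
  apply: countable_bigcupT_measurable; first exact: countableP.
  move=> z; apply: measurableI; first exact: mu.
  exact: mg.
have mD : measurable (Omega `\` N : set (lebesgueRn_type R n)) by exact: measurableD.
have hg : measurable_fun (Omega `\` N : set (lebesgueRn_type R n)) (superposition g u).
  apply: (@measurable_fun_cvg _ _ _ _ h).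
    by move=> k; apply: measurable_funS (mh k) => //; exact: subDsetl.
  move=> x [Ox Nx].
  have cg : continuous (g x).
    by apply: contrapT => ncg; apply: Nx; apply: gN => /(_ Ox).
  apply: (continuous_cvg _ (cg (u x))).
  apply: (@squeeze_cvgr _ _ _ _ (fun k => u x - k.+1%:R^-1) (fun=> u x)).
  - apply: nearW => k.
    have k0 : 0 < k.+1%:R :> R by [].
    apply/andP; split; last by rewrite ler_pdivrMr// mulrC floor_le.
    rewrite ler_pdivlMr// mulrBl mulVf ?gt_eqF// lerBlDr mulrC.
    by rewrite -[X in _ + X]/(1%:~R) -intrD ltW// floorD1_gt.
  - rewrite -[X in _ --> X]subr0; apply: cvgB; first exact: cvg_cst.
    exact: cvg_harmonic.
  - exact: cvg_cst.
pose f : lebesgueRn_type R n -> R := superposition g u \_ (Omega `\` N).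
apply/measurable_EFinP.
apply: (ae_measurable_fun (@lebesgueRn_complete R n) (f := EFin \o f)).
  exists N; split => // x /= /not_implyP[Ox fx]; apply: contrapT => Nx; apply: fx.
  by rewrite /f /= patchE mem_set.
apply/measurable_EFinP; apply: measurable_funTS.
exact/(measurable_restrictT _ mD).
Qed.

(** * The space L^2 on [Omega] and its norm *)

Lemma ge0_le_poweR (R : realType) (r : R) (x y : \bar R) : 0 <= r ->
  (0 <= x)%E -> (x <= y)%E -> (x `^ r <= y `^ r)%E.
Proof.
move=> r0 x0 xy; have y0 := le_trans x0 xy.
by apply: (gt0_ler_poweR r0 _ _ xy); rewrite in_itv/= leey andbT.
Qed.

Lemma le_Lnorm_ae d (T : measurableType d) (R : realType)
    (mu : {measure set T -> \bar R}) (p : R) (f h : T -> R) : 0 < p ->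
  measurable_fun setT f -> measurable_fun setT h ->
  {ae mu, forall x, `|f x| <= `|h x|} ->
  ('N[mu]_p%:E[EFin \o f] <= 'N[mu]_p%:E[EFin \o h])%E.
Proof.
move=> p0 mf mh fh; rewrite unlock.
have mpow (k : T -> R) : measurable_fun setT k ->
    measurable_fun setT (fun x => `|(EFin \o k) x| `^ p)%E.
  move=> mk; apply: (measurableT_comp (measurable_poweR _)).
  by apply: measurableT_comp => //; exact/measurable_EFinP.
apply: ge0_le_poweR; first by rewrite invr_ge0 ltW.
  by apply: integral_ge0 => x _; exact: poweR_ge0.
apply: (ae_ge0_le_integral measurableT).
- by move=> x _; exact: poweR_ge0.
- exact: mpow.
- by move=> x _; exact: poweR_ge0.
- exact: mpow.
move: fh; apply: filterS => x fhx _.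
by apply: ge0_le_poweR; rewrite ?abse_ge0 ?lee_fin// ltW.
Qed.

Section L2.
Context (R : realType) (n : nat) (Omega : set 'rV[R]_n).
Hypothesis mOmega : measurable (Omega : set (lebesgueRn_type R n)).
Implicit Types f h : 'rV[R]_n -> R.
Local Notation mu := (lebesgueRn R n).
Local Notation mfun_on f :=
  (measurable_fun (Omega : set (lebesgueRn_type R n)) f).

Let aeS := @filterS (lebesgueRn_type R n) (almost_everywhere mu) _.

Lemma ae_onS (P Q : 'rV[R]_n -> Prop) :
  (forall x, Omega x -> P x -> Q x) -> ae_on Omega P -> ae_on Omega Q.
Proof.
move=> PQ; rewrite /ae_on; apply: aeS.
by move=> x /[swap] Ox /(_ Ox); exact: PQ.
Qed.

Lemma ae_onW (P : 'rV[R]_n -> Prop) : (forall x, Omega x -> P x) -> ae_on Omega P.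
Proof. exact: (@aeW _ (lebesgueRn_type R n) R mu). Qed.

Lemma ae_onI (P Q : 'rV[R]_n -> Prop) :
  ae_on Omega P -> ae_on Omega Q -> ae_on Omega (fun x => P x /\ Q x).
Proof.
move=> aP aQ.
have := @filterI _ (almost_everywhere mu)
  (@ae_filter_ringOfSetsType _ (lebesgueRn_type R n) R mu) _ _ aP aQ.
by apply: aeS => x [Px Qx] Ox; split; [exact: Px|exact: Qx].
Qed.

Lemma restrict_add f h : (f \+ h) \_ Omega = (f \_ Omega) \+ (h \_ Omega).
Proof. by apply/funext => x; rewrite /= !patchE; case: ifP; rewrite ?addr0. Qed.

Lemma restrict_opp f : (\- f) \_ Omega = \- (f \_ Omega).
Proof. by apply/funext => x; rewrite /= !patchE; case: ifP; rewrite ?oppr0. Qed.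

Lemma restrict_mul f h : (f \* h) \_ Omega = (f \_ Omega) \* (h \_ Omega).
Proof. by apply/funext => x; rewrite /= !patchE; case: ifP; rewrite ?mulr0. Qed.

Lemma restrict_scale c f : (c \o* f) \_ Omega = c \o* (f \_ Omega).
Proof. by apply/funext => x; rewrite /= !patchE; case: ifP; rewrite ?mul0r. Qed.

Lemma measurable_fun_restrict f :
  mfun_on f <-> measurable_fun [set: lebesgueRn_type R n] (f \_ Omega).
Proof. exact: (@measurable_restrictT _ _ (lebesgueRn_type R n) _ _ f mOmega). Qed.

Lemma L2P f : L2 Omega f <-> mfun_on f /\
  ('N[mu]_2%:E[EFin \o (f \_ Omega)] < +oo)%E.
Proof.
rewrite measurable_fun_restrict /L2; split.
  by move=> /andP[/set_mem mf /set_mem].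
by case=> mf lf; apply/andP; split; exact/mem_set.
Qed.

Lemma L2norm_fin f : L2 Omega f ->
  (L2norm Omega f)%:E = 'N[mu]_2%:E[EFin \o (f \_ Omega)]%E.
Proof. by move=> /L2P[_ lf]; rewrite /L2norm fineK// ge0_fin_numE// Lnorm_ge0. Qed.

Lemma L2norm_ge0 f : 0 <= L2norm Omega f.
Proof. by rewrite /L2norm fine_ge0 ?Lnorm_ge0. Qed.

Lemma L2D f h : L2 Omega f -> L2 Omega h ->
  L2 Omega (f \+ h) /\ L2norm Omega (f \+ h) <= L2norm Omega f + L2norm Omega h.
Proof.
move=> Lf Lh; have Lfh : L2 Omega (f \+ h).
  by rewrite /L2 restrict_add; apply: (Lfun_addr_closed _ _).2; rewrite ?lee1n.
split => //; rewrite -lee_fin EFinD !L2norm_fin// restrict_add.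
move: Lf Lh => /L2P[/measurable_fun_restrict mf _] /L2P[/measurable_fun_restrict mh _].
exact: (minkowski_EFin mu mf mh (ler1n R 2)).
Qed.

Lemma L2N f : L2 Omega f -> L2 Omega (\- f) /\ L2norm Omega (\- f) = L2norm Omega f.
Proof.
move=> Lf; split; first by rewrite /L2 restrict_opp; apply: Lfun_oppr_closed.
by rewrite /L2norm restrict_opp; congr fine; exact: (oppe_Lnorm _ (EFin \o _)).
Qed.

Lemma L2B f h : L2 Omega f -> L2 Omega h ->
  L2 Omega (f \- h) /\ L2norm Omega (f \- h) <= L2norm Omega f + L2norm Omega h.
Proof. by move=> Lf /L2N[Lh <-]; exact: L2D. Qed.

Lemma L2Z c f : 0 <= c -> L2 Omega f ->
  L2 Omega (c \o* f) /\ L2norm Omega (c \o* f) = c * L2norm Omega f.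
Proof.
move=> c0 Lf; split; first by rewrite /L2 restrict_scale; apply: Lfun_scale; rewrite ?ler1n.
have p1 : (1 <= 2%:E :> \bar R)%E by rewrite lee1n.
pose F : LfunType mu p1 := Lfun_Sub p1 Lf.
rewrite /L2norm restrict_scale.
have := LnormZ F c; rewrite ger0_norm//.
rewrite (_ : _ \*: _ = c \o* (f \_ Omega)); last first.
  by apply/funext => x; rewrite /= mulrC.
move=> ->; rewrite fineM// ge0_fin_numE ?Lnorm_ge0//.
by case/L2P : (Lf).
Qed.

(** Yields membership in L^2 for superpositions and for the excess in [H10_bounded]. Domination does
    not give measurability, hence the separate hypothesis on [f]. *)
Lemma L2_dominated f h : mfun_on f -> L2 Omega h ->
  ae_on Omega (fun x => `|f x| <= `|h x|) ->
  L2 Omega f /\ L2norm Omega f <= L2norm Omega h.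
Proof.
move=> mf Lh fh; case/L2P : (Lh) => mh lh.
have le_fh : ('N[mu]_2%:E[EFin \o (f \_ Omega)] <=
              'N[mu]_2%:E[EFin \o (h \_ Omega)])%E.
  move/measurable_fun_restrict : mf => mf'; move/measurable_fun_restrict : mh => mh'.
  apply: (le_Lnorm_ae (ltr0Sn R 1) mf' mh').
  move: fh; apply: aeS => x fhx; rewrite !patchE.
  by case: ifPn => [/[!inE]/fhx|_].
have Lf : L2 Omega f by apply/L2P; split => //; exact: le_lt_trans lh.
by split => //; rewrite -lee_fin !L2norm_fin.
Qed.

Lemma L2norm0_ae f : L2 Omega f -> L2norm Omega f = 0 ->
  ae_on Omega (fun x => f x = 0).
Proof.
move=> Lf f0; have := L2norm_fin Lf; rewrite f0 => /esym N0.
have mf : measurable_fun [set: lebesgueRn_type R n] (EFin \o (f \_ Omega)).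
  by apply/measurable_EFinP/measurable_fun_restrict; case/L2P : Lf.
have := Lnorm_eq0_eq0 mf _ N0; rewrite lte_fin ltr0n => /(_ isT).
rewrite /ae_on; apply: aeS.
by move=> x /(_ I) + Ox; rewrite /= patchE mem_set// => -[].
Qed.

Lemma L2_integrableM f h : L2 Omega f -> L2 Omega h ->
  mu.-integrable Omega (EFin \o (f \* h)).
Proof.
move=> Lf Lh; have /Lfun1_integrable := Lfun2_mul_Lfun1 Lf Lh.
rewrite -restrict_mul (_ : EFin \o _ = (EFin \o (f \* h)) \_ Omega).
  by move=> /(integrable_restrict _ mOmega measurableT); rewrite setTI.
by apply/funext => x; rewrite /= !patchE; case: ifP.
Qed.

(** Hoelder's inequality with both exponents equal to 2. The absolute value stays inside the
    integral, so that [Cc_infty_sup] can enlarge a domain of integration beforehand. *)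
Lemma cauchy_schwarz f h : L2 Omega f -> L2 Omega h ->
  (\int[mu]_(x in Omega) `|(f x * h x)%:E| <= (L2norm Omega f * L2norm Omega h)%:E)%E.
Proof.
move=> Lf Lh; rewrite EFinM !L2norm_fin//.
have half : 2^-1 + 2^-1 = 1 :> R by rewrite [RHS]splitr !div1r.
have /measurable_fun_restrict mf : mfun_on f by case/L2P : Lf.
have /measurable_fun_restrict mh : mfun_on h by case/L2P : Lh.
apply: (le_trans _ (hoelder mu mf mh _ _ half)); rewrite ?ltr0n//.
rewrite Lnorm1 integral_mkcond -restrict_mul le_eqVlt; apply/orP; left; apply/eqP.
apply: eq_integral => x _; rewrite /= !patchE; case: ifP => _ /=; first by [].
by rewrite /point/= normr0.
Qed.

Lemma Lnorm2_sqr f : ('N[mu]_2%:E[EFin \o (f \_ Omega)] `^ 2 =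
  \int[mu]_(x in Omega) (f x ^+ 2)%:E)%E.
Proof.
rewrite powR_Lnorm ?pnatr_eq0// [RHS]integral_mkcond.
apply: eq_integral => x _; rewrite /= !patchE; case: ifP => _ /=.
  by rewrite powR_mulrn// real_normK// num_real.
by rewrite /point/= normr0 powR0// pnatr_eq0.
Qed.

Lemma L2norm_sqr f : L2 Omega f ->
  (\int[mu]_(x in Omega) (f x ^+ 2)%:E)%E = (L2norm Omega f ^+ 2)%:E.
Proof.
move=> Lf; rewrite -powR_mulrn ?L2norm_ge0// -poweR_EFin L2norm_fin//.
by rewrite Lnorm2_sqr.
Qed.

Lemma L2_sqr_lty f : mfun_on f ->
  (\int[mu]_(x in Omega) (f x ^+ 2)%:E < +oo)%E -> L2 Omega f.
Proof.
move=> mf; rewrite -Lnorm2_sqr => lf; apply/L2P; split => //.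
by apply: lty_poweRy lf; rewrite pnatr_eq0.
Qed.

End L2.

(** * The H^1 norm and the chosen weak derivatives *)

Lemma ler_sqrt_sqrD (R : rcfType) (a b : R) :
  0 <= a -> 0 <= b -> a <= Num.sqrt (a ^+ 2 + b).
Proof. by move=> a0 b0; rewrite -[leLHS]ger0_norm// -sqrtr_sqr ler_wsqrtr// lerDl. Qed.

Section H1norm.
Context (R : realType) (n : nat) (Omega : set 'rV[R]_n).
Implicit Types u : 'rV[R]_n -> R.

Lemma H1norm_ge0 u : 0 <= H1norm Omega u.
Proof. exact: sqrtr_ge0. Qed.

Lemma L2norm_le_H1norm u : L2norm Omega u <= H1norm Omega u.
Proof.
apply: ler_sqrt_sqrD; first exact: L2norm_ge0.
by apply: sumr_ge0 => i _; exact: sqr_ge0.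
Qed.

Lemma weak_partial_le_H1norm i u :
  L2norm Omega (weak_partial Omega i u) <= H1norm Omega u.
Proof.
rewrite /H1norm addrC (bigD1 i)//= -addrA.
apply: ler_sqrt_sqrD; first exact: L2norm_ge0.
by rewrite addr_ge0 ?sqr_ge0// sumr_ge0// => j _; exact: sqr_ge0.
Qed.

Lemma weak_partialP i u : H1 Omega u ->
  is_weak_partial Omega i u (weak_partial Omega i u).
Proof. by move=> [_ /(_ i)[v uv]]; exact: (xgetI (fun=> 0) uv). Qed.

End H1norm.

(** * Test functions *)

Lemma Cc_infty_continuous (R : realType) n (Omega : set 'rV[R]_n) phi :
  Cc_infty Omega phi -> continuous phi.
Proof. by case=> /(_ [::])[]. Qed.

Lemma Cc_infty_derivable (R : realType) n (Omega : set 'rV[R]_n) phi i x :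
  Cc_infty Omega phi -> derivable phi x (delta_mx ord0 i).
Proof. by case=> /(_ [::])[_ dphi] _ _; exact: dphi. Qed.

Lemma Cc_infty_out (R : realType) n (Omega : set 'rV[R]_n) phi x :
  Cc_infty Omega phi -> ~ Omega x -> phi x = 0.
Proof.
move=> [_ _ sO] Ox; apply: contrapT => /eqP phix; apply/Ox/sO.
exact: subset_closure.
Qed.

(** Off its closed support, [phi] vanishes on a neighbourhood, so its derivative vanishes there too
    and the support does not grow. *)
Lemma Cc_infty_partial (R : realType) n (Omega : set 'rV[R]_n) phi i :
  Cc_infty Omega phi -> Cc_infty Omega (partial i phi).
Proof.
move=> [sphi cphi phiO].
have clo : closure [set x | partial i phi x != 0] `<=` closure [set x | phi x != 0].
  rewrite [X in _ `<=` X](closure_id _).1; last exact: closed_closure.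
  apply: closureS => x /= dphix; apply: contrapT => nx; move/eqP : dphix; apply.
  have /(near_eq_derive (delta_mx ord0 i)) : \near x, phi x = cst 0 x.
    have : open_nbhs x (~` closure [set x | phi x != 0]).
      by split => //; apply: closed_openC; exact: closed_closure.
    move=> /open_nbhs_nbhs; apply: filterS => y ny; apply: contrapT => /eqP phiy.
    by apply: ny; exact: subset_closure.
  by rewrite derive_cst.
split; last exact: subset_trans phiO.
(* [foldr] applies the last entry first, so differentiating [partial i phi] along [s] is
   differentiating [phi] along [rcons s i]. *)
- by move=> s; have := sphi (rcons s i); rewrite foldr_rcons.
- by apply: subclosed_compact cphi clo; exact: closed_closure.
Qed.

(** * Dimension one: transfer of integrals and derivatives to the real line *)

Definition coord11 (R : realType) (x : lebesgueRn_type R 1) : measurableTypeR R :=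
  (x : 'rV[R]_1) ord0 ord0.

Lemma measurable_excess d (T : measurableType d) (R : realType) (D : set T)
    (u : T -> R) (k : R) :
  measurable_fun D u -> measurable_fun D (fun x => Num.max 0 (`|u x| - k)).
Proof.
move=> mu; apply: measurable_maxr; first exact: measurable_cst.
by apply: measurable_funB; [exact: measurableT_comp|exact: measurable_cst].
Qed.

Section dim1.
Context (R : realType).
Local Notation mu := (lebesgueRn R 1).
Local Notation leb := (@lebesgue_measure R).
Local Notation c := (@const_mx R 1 1).

Lemma const_mx11K (x : 'rV[R]_1) : c (x ord0 ord0) = x.
Proof. by apply/rowP => i; rewrite mxE (ord1 i). Qed.

Lemma continuous_const_mx11 : continuous (c : R -> 'rV[R]_1).
Proof.
move=> t; apply/cvg_ballP => e e0.
apply: filterS (nbhsx_ballx (t : R) e e0) => u tu.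
by split => // i j; rewrite !mxE.
Qed.

Lemma measurable_coord11 : measurable_fun [set: lebesgueRn_type R 1] (@coord11 R).
Proof.
move=> _ B mB; rewrite setTI; apply: measurable_lebesgueRn.
by rewrite -[X in measurable X]setTI; exact: (@measurable_coord R 1 ord0).
Qed.

(** The box formula with a single factor; it allows integrals over ['rV[R]_1] to be computed by
    pushing the measure forward. *)
Lemma pushforward_coord11 (B : set (measurableTypeR R)) : measurable B ->
  pushforward mu (@coord11 R) B = leb B.
Proof.
move=> mB; rewrite /pushforward.
have := @lebesgueRn_box R 1 (fun=> B) (fun=> mB); rewrite big_ord1 => <-.
by congr (mu _); apply/seteqP; split => x /= Bx => [i|]; [rewrite (ord1 i)|exact: Bx].
Qed.

(** Both difference quotients are the same function of [h], because moving [c t] by [h] along the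
    unit vector gives [c (h + t)]. *)
Lemma is_derive_const_mx11 (phi : 'rV[R]_1 -> R) t :
  derivable phi (c t) (delta_mx ord0 ord0) ->
  is_derive t 1 (phi \o c) (partial ord0 phi (c t)).
Proof.
have E : (fun h => h^-1 *: ((phi \o c \o shift t) (h *: 1) - (phi \o c) t)) =
         (fun h => h^-1 *: ((phi \o shift (c t)) (h *: delta_mx ord0 ord0) - phi (c t))).
  apply/funext => h; congr (_ *: (phi _ - _)).
  by apply/rowP => i; rewrite !mxE (ord1 i) eqxx.
by move=> dphi; split; rewrite /partial /derivable /derive E.
Qed.

Section bounded_open.
Variables (Omega : set 'rV[R]_1) (B : R).
Hypotheses (oO : open Omega) (B0 : 0 < B).
Hypothesis OB : forall x, Omega x -> `|x ord0 ord0| < B.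

Let mO := open_measurable_lebesgueRn oO.

(** [F] vanishes off [Omega], which lies between [- B] and [B], so both sides reduce to an integral
    over the preimage of [Omega] under [c]. Integrability comes from continuity on a compact
    interval. *)
Lemma integral_dim1 (F : 'rV[R]_1 -> R) :
  continuous F -> (forall x, ~ Omega x -> F x = 0) ->
  mu.-integrable Omega (EFin \o F) /\
  (\int[mu]_(x in Omega) (F x)%:E = \int[leb]_(t in `[(- B)%R, B]) (F (c t))%:E)%E.
Proof.
move=> cF F0; pose D := c @^-1` Omega; pose G := F \o c.
have cG : continuous G.
  by move=> t; apply: continuous_comp; [exact: continuous_const_mx11|exact: cF].
have mG : measurable_fun [set: measurableTypeR R] (EFin \o G).
  by apply/measurable_EFinP; exact: continuous_measurable_fun.
have mabsG : measurable_fun [set: measurableTypeR R] (fun t => `|(G t)%:E|%E).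
  exact: (measurableT_comp _ mG).
have mD : measurable D.
  apply: open_measurable; apply: open_comp => // t _; exact: continuous_const_mx11.
have intI : leb.-integrable `[(- B)%R, B] (EFin \o G).
  apply: continuous_compact_integrable; first exact: segment_compact.
  exact: continuous_subspaceT.
(* Used with [h] the absolute value for integrability, and with [EFin] for the value of the
   integral. *)
have patchG (h : R -> \bar R) : h 0 = 0%E ->
    (h \o G) \_ D = (h \o G) \_ `[(- B)%R, B]%classic.
  move=> h0; apply/funext => t; rewrite !patchE.
  case: ifPn => [/set_mem Dt|/negP Dt].
    have := OB Dt; rewrite mxE ltr_norml => /andP[/ltW Bt /ltW tB].
    by rewrite mem_set//= in_itv/= Bt tB.
  case: ifP => // _; rewrite /= /G /= F0 ?h0//.
  by move=> Ot; apply: Dt; exact: mem_set.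
have preD : (@coord11 R) @^-1` D = Omega.
  by apply/seteqP; split => x; rewrite /D/= /coord11 const_mx11K.
have GF : (EFin \o G) \o (@coord11 R) = EFin \o F.
  by apply/funext => x; rewrite /G/= /coord11 const_mx11K.
have pfE (h : measurableTypeR R -> \bar R) :
    (\int[pushforward mu (@coord11 R)]_(t in D) h t =
     \int[leb]_(t in D) h t)%E.
  by apply: (@eq_measure_integral _ (measurableTypeR R)) => [|mf A mA _];
    [exact: measurable_coord11|exact: pushforward_coord11].
(* The change of variables for a signed integrand requires integrability, which is first obtained
   from the nonnegative version applied to the absolute value. *)
have intO : mu.-integrable Omega (EFin \o F).
  apply/integrableP; split.
    rewrite -GF; apply: measurable_funTS.
    exact: (measurableT_comp mG measurable_coord11).
  have /integrableP[_] := intI; apply: le_lt_trans.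
  rewrite [leRHS]integral_mkcond -(patchG (fun r => `|r%:E|%E)) ?abse0//.
  rewrite -integral_mkcond -pfE (ge0_integral_pushforward measurable_coord11)//; last 2 first.
  - exact: measurable_funTS mabsG.
  - by move=> t _; exact: abse_ge0.
  rewrite preD le_eqVlt; apply/orP; left; apply/eqP/eq_integral => x _.
  by rewrite /G/= /coord11 const_mx11K.
split => //.
rewrite [RHS]integral_mkcond -(patchG EFin)// -integral_mkcond -pfE.
rewrite (integral_pushforward measurable_coord11)//; last by rewrite preD GF.
by rewrite preD GF.
Qed.

(** [Omega] lies in a bounded box, hence has finite measure. *)
Lemma L2_cst_dim1 k : L2 Omega (cst k).
Proof.
apply: (L2_sqr_lty mO) => //.
rewrite (_ : (fun _ => _) = cst (k ^+ 2)%:E)// integral_cst//.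
have muO : (mu Omega < +oo)%E.
  pose K := [set x : 'rV[R]_1 | forall i, `[- B, B]%classic (x ord0 i)].
  have mI (i : 'I_1) : measurable (`[- B, B]%classic : set R) by [].
  have mK : measurable (K : set (lebesgueRn_type R 1)).
    exact: measurable_lebesgueRn (measurable_box mI).
  apply: (@le_lt_trans _ _ (mu K)).
    apply: le_measure; rewrite ?inE//.
    move=> x Ox i; rewrite (ord1 i)/= in_itv/= -ler_norml; exact/ltW/OB.
  have := lebesgueRn_box mI; rewrite big_ord1 => ->.
  rewrite lebesgue_measure_itv/=; case: ifP => _; by rewrite ?ltry// -EFinB ltry.
by rewrite lte_mul_pinfty// lee_fin sqr_ge0.
Qed.

(** The square of [F] is again continuous and zero off [Omega], so [integral_dim1] applies to it. *)
Lemma L2_continuous_dim1 F : continuous F -> (forall x, ~ Omega x -> F x = 0) ->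
  L2 Omega F.
Proof.
move=> cF F0; apply: (L2_sqr_lty mO).
  by have [/integrableP[/measurable_EFinP]] := integral_dim1 cF F0.
have cF2 : continuous (fun x => F x ^+ 2).
  by move=> x; exact: (continuousM (cF x) (cF x)).
have F20 x : ~ Omega x -> F x ^+ 2 = 0 by move=> /F0 ->; rewrite expr0n.
have [/integrableP[_ F2oo] _] := integral_dim1 cF2 F20.
apply: le_lt_trans F2oo; rewrite le_eqVlt; apply/orP; left; apply/eqP.
by apply: eq_integral => x _; rewrite /= ger0_norm// sqr_ge0.
Qed.

(** * Dimension one: sup bound and integration by parts for test functions *)

Lemma L2_Cc_infty_dim1 phi : Cc_infty Omega phi -> L2 Omega phi.
Proof.
move=> Cphi; apply: L2_continuous_dim1; first exact: Cc_infty_continuous Cphi.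
by move=> x; exact: Cc_infty_out Cphi.
Qed.

Lemma FTC2_dim1 F t : continuous F ->
  (forall x, derivable F x (delta_mx ord0 ord0)) ->
  continuous (partial ord0 F) -> - B < t ->
  (\int[leb]_(y in `[(- B)%R, t]) (partial ord0 F (c y))%:E =
   (F (c t))%:E - (F (c (- B)))%:E)%E.
Proof.
move=> cF dF cpF Bt.
have cFc : continuous (F \o c).
  by move=> y; apply: continuous_comp; [exact: continuous_const_mx11|exact: cF].
have dFc y := is_derive_const_mx11 (dF (c y)).
apply: (continuous_FTC2 (F := F \o c)) => //.
- apply: continuous_subspaceT => y.
  by apply: continuous_comp; [exact: continuous_const_mx11|exact: cpF].
- split => [y _||]; first exact: ex_derive.
    by apply: cvg_at_right_filter; exact: cFc.
  by apply: cvg_at_left_filter; exact: cFc.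
- by move=> y _; rewrite derive1E derive_val.
Qed.

(** The bound [OB] is strict, so both endpoints lie outside [Omega]. This removes the boundary terms
    from the fundamental theorem of calculus. *)
Lemma boundary_dim1 (F : 'rV[R]_1 -> R) : (forall x, ~ Omega x -> F x = 0) ->
  F (c B) = 0 /\ F (c (- B)) = 0.
Proof.
by move=> F0; split; apply: F0 => /OB; rewrite mxE ?normrN gtr0_norm// ltxx.
Qed.

Lemma Cc_infty_sup phi x : Cc_infty Omega phi -> Omega x ->
  `|phi x| <= L2norm Omega (cst 1) * L2norm Omega (partial ord0 phi).
Proof.
move=> Cphi Ox; have Cdphi := Cc_infty_partial ord0 Cphi.
have cdphi := Cc_infty_continuous Cdphi.
have dphi0 y : ~ Omega y -> partial ord0 phi y = 0 := Cc_infty_out Cdphi.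
have Ldphi := L2_Cc_infty_dim1 Cdphi.
have := OB Ox; rewrite ltr_norml => /andP[Bx xB].
have dphi y : derivable phi y (delta_mx ord0 ord0) := Cc_infty_derivable Cphi.
have := FTC2_dim1 (Cc_infty_continuous Cphi) dphi cdphi Bx.
have phi0 y : ~ Omega y -> phi y = 0 := Cc_infty_out Cphi.
rewrite (boundary_dim1 phi0).2 sube0 const_mx11K => phixE.
have cabs : continuous (fun y => `|partial ord0 phi y|).
  by move=> y; apply: continuous_comp; [exact: cdphi|exact: norm_continuous].
have abs0 y : ~ Omega y -> `|partial ord0 phi y| = 0 by move=> /dphi0 ->; rewrite normr0.
have [_ IE] := integral_dim1 cabs abs0.
rewrite -lee_fin -abse_EFin -phixE.
(* Pairing the derivative with the constant 1 produces the factor [L2norm Omega (cst 1)]; it remains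
   to enlarge the integral up to [x] to the whole interval. *)
apply: (le_trans _ (cauchy_schwarz mO (L2_cst_dim1 1) Ldphi)).
under eq_integral do rewrite mul1r.
rewrite IE.
have cdphic : continuous (partial ord0 phi \o c).
  by move=> y; apply: continuous_comp; [exact: continuous_const_mx11|exact: cdphi].
have mdphi : measurable_fun [set: measurableTypeR R] (fun y => (partial ord0 phi (c y))%:E).
  by apply/measurable_EFinP; exact: continuous_measurable_fun cdphic.
apply: le_trans (le_abse_integral _ _ _) _ => //; first exact: measurable_funTS mdphi.
apply: ge0_subset_integral => //.
  by apply: (measurable_funS measurableT) => //; exact: measurableT_comp.
by apply: subset_itvl; rewrite bnd_simp ltW.
Qed.

(** The product of [phi] and [psi] vanishes at both endpoints, so its derivative has integral
    zero. *)
Lemma Cc_infty_by_parts phi psi : Cc_infty Omega phi -> Cc_infty Omega psi ->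
  Rintegral mu Omega (fun x => phi x * partial ord0 psi x) =
  - Rintegral mu Omega (fun x => partial ord0 phi x * psi x).
Proof.
move=> Cphi Cpsi; have [Cdphi Cdpsi] := (Cc_infty_partial ord0 Cphi, Cc_infty_partial ord0 Cpsi).
have [cphi cpsi] := (Cc_infty_continuous Cphi, Cc_infty_continuous Cpsi).
have [cdphi cdpsi] := (Cc_infty_continuous Cdphi, Cc_infty_continuous Cdpsi).
have dphi x : derivable phi x (delta_mx ord0 ord0) := Cc_infty_derivable Cphi.
have dpsi x : derivable psi x (delta_mx ord0 ord0) := Cc_infty_derivable Cpsi.
pose F := phi \* psi.
have cF : continuous F by move=> x; apply: continuousM; [exact: cphi|exact: cpsi].
have dF x : derivable F x (delta_mx ord0 ord0) by exact: derivableM.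
have dFE : partial ord0 F = fun x => phi x * partial ord0 psi x + partial ord0 phi x * psi x.
  by apply/funext => x; rewrite /partial deriveM// /GRing.scale/= [psi x * _]mulrC.
have cdF : continuous (partial ord0 F).
  rewrite dFE => x.
  exact: (continuousD (continuousM (cphi x) (cdpsi x)) (continuousM (cdphi x) (cpsi x))).
have dF0 x : ~ Omega x -> partial ord0 F x = 0.
  by move=> Ox; rewrite dFE (Cc_infty_out Cphi)// (Cc_infty_out Cpsi)// mul0r mulr0 addr0.
have F0 x : ~ Omega x -> F x = 0 by move=> /(Cc_infty_out Cphi); rewrite /F/= => ->; rewrite mul0r.
have [_ IF] := integral_dim1 cdF dF0.
have BB : - B < B by rewrite gtrN.
have := FTC2_dim1 cF dF cdF BB; rewrite !(boundary_dim1 F0).1 !(boundary_dim1 F0).2 -IF sube0.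
move=> /(congr1 fine) /=; rewrite -/(Rintegral _ _ _) dFE.
rewrite RintegralD//; last 2 first.
- by apply: L2_integrableM => //; exact: L2_Cc_infty_dim1.
- by apply: L2_integrableM => //; exact: L2_Cc_infty_dim1.
by move/eqP; rewrite addr_eq0 => /eqP.
Qed.

(** * Dimension one: weak derivatives and the almost everywhere bound on H^1_0 *)

Lemma Cc_infty_weak_partial phi : Cc_infty Omega phi ->
  is_weak_partial Omega ord0 phi (partial ord0 phi).
Proof.
move=> Cphi; split; first exact: L2_Cc_infty_dim1 (Cc_infty_partial ord0 Cphi).
by move=> psi Cpsi; exact: Cc_infty_by_parts.
Qed.

(* Test the weak formulation against [partial ord0 phi], itself a test function. *)
Lemma Cc_infty_weak_partial_min phi v : Cc_infty Omega phi ->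
  is_weak_partial Omega ord0 phi v ->
  L2norm Omega (partial ord0 phi) <= L2norm Omega v.
Proof.
move=> Cphi [Lv phiv]; have Cdphi := Cc_infty_partial ord0 Cphi.
have [Ldphi _] := Cc_infty_weak_partial Cphi.
(* The integral of [phi] times its second derivative is computed in two ways, so the square of
   [partial ord0 phi] and its product with [v] have the same integral. *)
have /oppr_inj := etrans (esym (Cc_infty_by_parts Cphi Cdphi)) (phiv _ Cdphi).
have -> : Rintegral mu Omega (fun x => partial ord0 phi x * partial ord0 phi x) =
    L2norm Omega (partial ord0 phi) ^+ 2.
  by rewrite /Rintegral; have /(congr1 fine) /= <- := L2norm_sqr mO Ldphi.
(* The estimate to come is quadratic in this norm, and dividing by the norm requires it to be
   nonzero. *)
have [->|d0] := eqVneq (L2norm Omega (partial ord0 phi)) 0; first by rewrite L2norm_ge0.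
have {}d0 : 0 < L2norm Omega (partial ord0 phi) by rewrite lt_neqAle eq_sym d0 L2norm_ge0.
move=> dv; rewrite -(ler_pM2r d0) -expr2 dv.
apply: (le_trans (ler_norm _)); rewrite -lee_fin.
have int := L2_integrableM mO Lv Ldphi.
rewrite EFin_normr_Rintegral//.
apply: le_trans (cauchy_schwarz mO Lv Ldphi).
exact: (le_abse_integral mu mO (measurable_int mu int)).
Qed.

(** [weak_partial] is chosen separately for each function and need not be additive, so linearity is
    established for the relation. *)
Lemma is_weak_partial_sub u1 u2 v1 v2 :
  L2 Omega u1 -> L2 Omega u2 ->
  is_weak_partial Omega ord0 u1 v1 -> is_weak_partial Omega ord0 u2 v2 ->
  is_weak_partial Omega ord0 (u1 \- u2) (v1 \- v2).
Proof.
move=> Lu1 Lu2 [Lv1 uv1] [Lv2 uv2]; split; first by have [] := L2B mO Lv1 Lv2.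
move=> phi Cphi.
have Lphi := L2_Cc_infty_dim1 Cphi.
have Ldphi := L2_Cc_infty_dim1 (Cc_infty_partial ord0 Cphi).
have subE (f h k : 'rV[R]_1 -> R) : L2 Omega f -> L2 Omega h -> L2 Omega k ->
    Rintegral mu Omega (fun x => (f \- h) x * k x) =
    Rintegral mu Omega (fun x => f x * k x) - Rintegral mu Omega (fun x => h x * k x).
  move=> Lf Lh Lk; rewrite -RintegralB//.
  - by apply: eq_Rintegral => x _; rewrite mulrBl.
  - exact: L2_integrableM.
  - exact: L2_integrableM.
by rewrite !subE// uv1// uv2// opprB opprK addrC.
Qed.

(** Guarantees that [weak_partial] of [u \- phi] is a genuine weak derivative and not the default
    value of [xget]. *)
Lemma H1_sub_Cc_infty u phi : H1 Omega u -> Cc_infty Omega phi ->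
  H1 Omega (u \- phi).
Proof.
move=> [Lu hu] Cphi; have Lphi := L2_Cc_infty_dim1 Cphi; split.
  by have [] := L2B mO Lu Lphi.
move=> i; rewrite (ord1 i); have [v uv] := hu ord0.
exists (v \- partial ord0 phi).
exact: is_weak_partial_sub (Cc_infty_weak_partial Cphi).
Qed.

Lemma H10_bounded u : H10 Omega u ->
  ae_on Omega (fun x => `|u x| <= L2norm Omega (cst 1) * (1 + H1norm Omega u)).
Proof.
move=> [Hu uC]; set K := L2norm Omega (cst 1); set N := H1norm Omega u.
have K0 : 0 <= K := L2norm_ge0 _ _.
have Lu : L2 Omega u := Hu.1.
pose f (x : 'rV[R]_1) : R := Num.max 0 (`|u x| - K * (1 + N)).
have mf : measurable_fun (Omega : set (lebesgueRn_type R 1)) f.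
  by apply: measurable_excess; have /(L2P mO)[] := Lu.
(* In the bound on the derivative of [phi], [u] contributes [N] and [u \- phi] at most [e]. Since
   [e <= 1], the threshold in [f] can be fixed independently of [phi]. *)
have small e : 0 < e <= 1 -> L2 Omega f /\ L2norm Omega f <= e.
  move=> /andP[e0 e1]; have [phi Cphi uphi] := uC e e0.
  have Hw := H1_sub_Cc_infty Hu Cphi.
  have lew := L2norm_le_H1norm Omega (u \- phi).
  have lev := weak_partial_le_H1norm Omega ord0 (u \- phi).
  have phiE : phi = u \- (u \- phi) by apply/funext => x /=; rewrite opprB addrCA subrr addr0.
  have Wphi := is_weak_partial_sub Lu Hw.1 (weak_partialP ord0 Hu) (weak_partialP ord0 Hw).
  rewrite -phiE in Wphi.
  have dphi : L2norm Omega (partial ord0 phi) <= 1 + N.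
    apply: (le_trans (Cc_infty_weak_partial_min Cphi Wphi)).
    have [_ nB] := L2B mO (weak_partialP ord0 Hu).1 (weak_partialP ord0 Hw).1.
    apply: (le_trans nB); rewrite [leRHS]addrC; apply: lerD.
      exact: weak_partial_le_H1norm.
    exact: (le_trans lev (le_trans (ltW uphi) e1)).
  have [Lf lf] : L2 Omega f /\ L2norm Omega f <= L2norm Omega (u \- phi).
    (* Pointwise, [|u| - K (1 + N) <= |u| - |phi| <= |u - phi|], by [Cc_infty_sup] and [dphi]. *)
    apply: (L2_dominated mO) => //; first exact: Hw.1.
    apply: ae_onW => x Ox; rewrite ger0_norm ?le_max ?lexx// ge_max normr_ge0/=.
    rewrite lerBlDr -[X in `|X|](subrK (phi x)) (le_trans (ler_normD _ _))// lerD2l.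
    by rewrite (le_trans (Cc_infty_sup Cphi Ox))// ler_wpM2l.
  by split => //; rewrite (le_trans lf)// (le_trans lew)// ltW.
have [Lf _] : L2 Omega f /\ L2norm Omega f <= 1 by apply: small; rewrite ltr01 lexx.
have f0 : L2norm Omega f = 0.
  apply/eqP; rewrite eq_le L2norm_ge0 andbT; apply/ler_addgt0Pl => e e0.
  rewrite addr0; have [|_ /le_trans] := small (Num.min e 1).
    by rewrite lt_min e0 ltr01 ge_min lexx orbT.
  by apply; rewrite ge_min lexx.
apply: ae_onS (L2norm0_ae mO Lf f0) => x Ox fx0; rewrite -subr_le0 -[leRHS]fx0.
by rewrite le_max lexx orbT.
Qed.

End bounded_open.
End dim1.

(** * Bounds for the superposition operator *)

Section superposition.
Context (R : realType) (n : nat) (Omega : set 'rV[R]_n).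
Hypothesis mO : measurable (Omega : set (lebesgueRn_type R n)).
Variable g : 'rV[R]_n -> R -> R.
Hypothesis cg : caratheodory_function Omega g.

(** The Lipschitz bound is asked only along the two given functions, which covers both a global
    constant and one valid on a bounded range. *)
Lemma superposition_lipschitz (L : R) u1 u2 : 0 <= L -> L2 Omega u1 -> L2 Omega u2 ->
  ae_on Omega (fun x => `|g x (u1 x) - g x (u2 x)| <= L * `|u1 x - u2 x|) ->
  L2 Omega (superposition g u1 \- superposition g u2) /\
  L2norm Omega (superposition g u1 \- superposition g u2) <=
    L * L2norm Omega (u1 \- u2).
Proof.
move=> L0 Lu1 Lu2 gL; have [Lu _] := L2B mO Lu1 Lu2; have [LLu <-] := L2Z mO L0 Lu.
have /(L2P mO)[mu1 _] := Lu1; have /(L2P mO)[mu2 _] := Lu2.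
apply: (L2_dominated mO) => //.
  exact: measurable_funB (measurable_superposition mO cg mu1)
                         (measurable_superposition mO cg mu2).
apply: ae_onS gL => x _ gLx.
by rewrite /= normrM [ `|L| ]ger0_norm// mulrC.
Qed.

End superposition.

(** [1 + N] is at most twice the larger of 1 and [N], and the larger of their powers is at most the
    sum. *)
Lemma powR_1D (R : realType) (N s : R) : 0 <= N -> 0 <= s ->
  (1 + N) `^ s <= 2 `^ s * (1 + N `^ s).
Proof.
move=> N0 s0; have [N1|N1] := leP N 1.
  apply: (@le_trans _ _ (2 `^ s)).
    by rewrite ge0_ler_powR ?nnegrE ?addr_ge0// -[leRHS]/(1 + 1) lerD2l.
  by rewrite ler_peMr ?powR_ge0// lerDl powR_ge0.
apply: (@le_trans _ _ ((2 * N) `^ s)).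
  by rewrite ge0_ler_powR ?nnegrE ?addr_ge0 ?mulr_ge0// mulr_natl mulr2n lerD2r ltW.
by rewrite powRM// ler_wpM2l ?powR_ge0// lerDr.
Qed.

(** Splitting off [g ^~ 0] leaves a difference of norm at most [L] times that of [u]. The exponent 1
    is kept as a power to match the theorem at [s = 1]. *)
Lemma superposition_bounds_C (R : realType) (n : nat) (Omega : set 'rV[R]_n)
    (g : 'rV[R]_n -> R -> R) : open Omega -> assumptionC Omega g ->
  (exists2 C : R, 0 < C &
     forall u, H10 Omega u ->
       L2 Omega (superposition g u) /\
       L2norm Omega (superposition g u) <= C * (1 + H1norm Omega u `^ 1)) /\
  (forall M : R, 0 < M -> exists2 CM : R, 0 < CM &
     forall u1 u2, H10 Omega u1 -> H10 Omega u2 ->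
       H1norm Omega u1 <= M -> H1norm Omega u2 <= M ->
       L2norm Omega (superposition g u1 \- superposition g u2) <=
         CM * L2norm Omega (u1 \- u2)).
Proof.
move=> /open_measurable_lebesgueRn mO [cg _ Lg0 [L L0 gL]].
have lip u1 u2 : L2 Omega u1 -> L2 Omega u2 ->
    L2 Omega (superposition g u1 \- superposition g u2) /\
    L2norm Omega (superposition g u1 \- superposition g u2) <= L * L2norm Omega (u1 \- u2).
  move=> Lu1 Lu2; apply: (superposition_lipschitz mO cg) => //; first exact: ltW.
  by apply: ae_onS (gL 0%N isT) => x _; exact.
split; last first.
  by move=> M _; exists L => // u1 u2 [[Lu1 _] _] [[Lu2 _] _] _ _; exact: (lip _ _ Lu1 Lu2).2.
(* With [A] the norm of [g ^~ 0], the bound [A + L N] is at most [(A + L) (1 + N)]. *)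
exists (L2norm Omega (g ^~ 0) + L) => [|u [[Lu _] _]].
  by rewrite ltr_wpDl// L2norm_ge0.
have [mz _] := (L2Z mO (lexx 0) Lu); have L2z : L2 Omega (cst 0).
  by rewrite (_ : cst 0 = 0 \o* u)//; apply/funext => x; rewrite /= mulr0.
have [Ld ld] := lip u (cst 0) Lu L2z.
have [Ls ls] := L2D mO Ld Lg0.
have E : (superposition g u \- superposition g (cst 0)) \+ g ^~ 0 = superposition g u.
  by apply/funext => x; rewrite /superposition /= subrK.
rewrite E in Ls ls; split => //.
have E0 : u \- cst 0 = u by apply/funext => x; rewrite /= subr0.
rewrite E0 in ld.
have N0 := H1norm_ge0 Omega u; have uN := L2norm_le_H1norm Omega u.
rewrite powRr1//; apply: (le_trans ls).
have A0 : 0 <= L2norm Omega (g ^~ 0) := L2norm_ge0 _ _.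
move: ld uN N0 A0; move: (L2norm _ _) (L2norm _ u) (H1norm _ _) (L2norm _ (g ^~ 0)).
move=> p q N A pq qN N0 A0.
have LqN : L * q <= L * N by rewrite ler_pM2l.
rewrite mulrDr mulr1 mulrDl; have : 0 <= A * N by rewrite mulr_ge0.
lra.
Qed.

Lemma superposition_bounds_B (R : realType) (Omega : set 'rV[R]_1)
    (g : 'rV[R]_1 -> R -> R) (s : R) : bounded_domain Omega -> assumptionB Omega g s ->
  (exists2 C : R, 0 < C &
     forall u, H10 Omega u ->
       L2 Omega (superposition g u) /\
       L2norm Omega (superposition g u) <= C * (1 + H1norm Omega u `^ s)) /\
  (forall M : R, 0 < M -> exists2 CM : R, 0 < CM &
     forall u1 u2, H10 Omega u1 -> H10 Omega u2 ->
       H1norm Omega u1 <= M -> H1norm Omega u2 <= M ->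
       L2norm Omega (superposition g u1 \- superposition g u2) <=
         CM * L2norm Omega (u1 \- u2)).
Proof.
move=> [_ oO _ bO] [cg _ glip [s1 [b [a [b0 La ga]]]]].
have mO := open_measurable_lebesgueRn oO.
have s0 : 0 <= s := le_trans ler01 s1.
(* [bounded_set] bounds the norm by any number above [M0]. Adding 1 gives such a number, a second 1
   makes the bound strict, and the maximum with 0 makes it positive. *)
have [B B0 OB] : exists2 B : R, 0 < B & forall x, Omega x -> `|x ord0 ord0| < B.
  have [M0 [_ hM]] := bO; exists (Num.max M0 0 + 2).
    by rewrite ltr_wpDl ?le_max ?lexx ?orbT.
  move=> x Ox; have /hM/(_ _ Ox)/= xM : M0 < Num.max M0 0 + 1.
    by rewrite ltr_pwDr ?le_max ?lexx.
  apply: (le_lt_trans _ (le_lt_trans xM _)); last by rewrite ltrD2l ltr1n.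
  rewrite [leRHS]/Num.Def.normr/= mx_normrE.
  by apply/bigmax_geP; right => /=; exists (ord0, ord0).
pose K := L2norm Omega (cst 1); have K0 : 0 <= K := L2norm_ge0 _ _.
have bnd u : H10 Omega u -> ae_on Omega (fun x => `|u x| <= K * (1 + H1norm Omega u)).
  exact: (H10_bounded oO B0 OB).
split.
  (* The leading terms bound [L2norm Omega a + k * K] once [powR_1D] is applied inside [k]; the
     final 1 makes the constant positive. *)
  exists (L2norm Omega a + b * K `^ s * K * 2 `^ s + 1) => [|u Hu].
    by rewrite ltr_wpDl// addr_ge0 ?L2norm_ge0// !mulr_ge0 ?powR_ge0// ltW.
  set N := H1norm Omega u; have N0 : 0 <= N := H1norm_ge0 _ _.
  pose k := b * (K * (1 + N)) `^ s.
  have k0 : 0 <= k by rewrite mulr_ge0 ?powR_ge0// ltW.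
  have L1 : L2 Omega (cst 1) := L2_cst_dim1 oO OB 1.
  have [Lk lk] := L2Z mO k0 L1; have [Lh lh] := L2D mO La Lk.
  have /(L2P mO)[mu _] : L2 Omega u := Hu.1.1.
  have [LG lG] : L2 Omega (superposition g u) /\
      L2norm Omega (superposition g u) <= L2norm Omega (a \+ k \o* cst 1).
    apply: (L2_dominated mO) => //; first exact: measurable_superposition.
    apply: ae_onS (ae_onI ga (bnd _ Hu)) => x _ [gx ux].
    apply: (le_trans (gx _)); rewrite /= mul1r (le_trans _ (ler_norm _))// lerD2l.
    rewrite ler_pM2l//; apply: ge0_ler_powR => //.
    by rewrite nnegrE mulr_ge0// addr_ge0.
  split => //; apply: (le_trans lG); apply: (le_trans lh); rewrite lk -/K.
  have kE : k * K <= b * K `^ s * K * 2 `^ s * (1 + N `^ s).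
    rewrite /k powRM ?addr_ge0// -!mulrA ler_pM2l// ler_wpM2l ?powR_ge0//.
    by rewrite mulrC ler_wpM2l// powR_1D.
  have A0 := L2norm_ge0 Omega a; have P0 := powR_ge0 N s.
  rewrite 2!mulrDl mul1r; have := mulr_ge0 A0 P0; lra.
(* [K] is only known to be nonnegative, so adding 1 gives a positive radius for the local Lipschitz
   condition. *)
move=> M M0; have K1 : 0 < K * (1 + M) + 1.
  by rewrite ltr_wpDl// mulr_ge0// addr_ge0// ltW.
have [L L0 gL] := glip _ K1; exists L; first exact: L0.
move=> u1 u2 Hu1 Hu2 u1M u2M.
apply: (superposition_lipschitz mO cg _ Hu1.1.1 Hu2.1.1 _).2; first exact: ltW.
apply: ae_onS (ae_onI (gL 0%N isT) (ae_onI (bnd _ Hu1) (bnd _ Hu2))) => x _ [gx [u1x u2x]].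
have le_bnd (N r : R) : N <= M -> r <= K * (1 + N) -> r <= K * (1 + M) + 1.
  move=> NM rN; apply: (le_trans rN); rewrite ler_wpDr// ler_wpM2l// lerD2l//.
by apply: gx; [exact: le_bnd u1M u1x|exact: le_bnd u2M u2x].
Qed.

Theorem lemma2p1 (R : realType) (n : nat) (n_range : (1 <= n <= 3)%N)
  (Omega : set 'rV[R]_n) (Omega_domain : bounded_domain Omega)
  (Omega_C11 : C11_boundary Omega)
  (g : 'rV[R]_n -> R -> R) (s : R)
  (gB : n = 1%N -> assumptionB Omega g s)
  (gC : n = 2%N \/ n = 3%N -> assumptionC Omega g /\ s = 1) :
  (exists2 C : R, 0 < C &
     forall u, H10 Omega u ->
       L2 Omega (superposition g u) /\
       L2norm Omega (superposition g u) <= C * (1 + H1norm Omega u `^ s)) /\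
  (forall M : R, 0 < M -> exists2 CM : R, 0 < CM &
     forall u1 u2, H10 Omega u1 -> H10 Omega u2 ->
       H1norm Omega u1 <= M -> H1norm Omega u2 <= M ->
       L2norm Omega (superposition g u1 \- superposition g u2) <=
         CM * L2norm Omega (u1 \- u2)).
Proof.
have [n1|n23] : n = 1%N \/ (n = 2%N \/ n = 3%N).
  by case: n n_range {Omega Omega_domain Omega_C11 g gB gC} => [|[|[|[|]]]]//; tauto.
  move: (gB n1) => {gC gB Omega_C11 n_range}; subst n; exact: superposition_bounds_B.
have [gC' ->] := gC n23; have [_ oO _ _] := Omega_domain; exact: superposition_bounds_C.
Qed.
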